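(* Let $p$ be prime, $a\ge1$, $q=p^a$, $n,d\ge1$. Let $\bar F\in\mathbf F_q[x]_d$ and let $X$ be the hypersurface in $\mathbf T^n_{\mathbf F_q}$ cut out by $\bar F$. Let $r,\lambda,\tau$ be positive integers with $\tau\ge\frac{\lambda}{(p-1)ar}$. Let $F\in\mathbf Z_q[x]_d$ be any lift of $\bar F$. Then $$|X(\mathbf F_{q^r})|\equiv(q^r-1)^n\sum_{s=0}^{\lambda+\tau-1}\alpha_s\operatorname{trace}(A_{F^s}^{ar})\pmod{p^\lambda},$$ where $\alpha_s=(-1)^s\sum_{t=0}^{\tau-1}\binom{-\lambda}{t}\binom{\lambda}{s-t}\in\mathbf Z$, and $A_{F^s}^{ar}$ is regarded as a $\mathbf Z_q$-linear operator on $\mathbf Z_q[x]_{ds}$, with trace taken with respect to the monomial basis $\{x^w:w\in B_{ds}\}$ (for $s=0$, $\mathbf Z_q[x]_0=\mathbf Z_q$).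
   Context: For a ring $R$, $R[x]=R[x_0,\dots,x_n]$; $R[x]_k$ is the module of homogeneous polynomials of degree $k$, with basis $x^u=x_0^{u_0}\cdots x_n^{u_n}$ for $u\in B_k=\{u\in\mathbf N^{n+1}:u_0+\cdots+u_n=k\}$. For $G\in R[x]$ and $u\in\mathbf Z^{n+1}$, $G_u$ is the coefficient of $x^u$ (zero if some $u_i<0$). $\mathbf Z_q$ is the ring of Witt vectors of $\mathbf F_q$ (ring of integers of the unramified extension of $\mathbf Q_p$ of degree $a$), and $\phi:\mathbf Z_q\to\mathbf Z_q$ is the Frobenius automorphism lifting $u\mapsto u^p$ on $\mathbf F_q$. Define $\phi,\psi:\mathbf Z_q[x]\to\mathbf Z_q[x]$ by $\phi(G)=\sum_u\phi(G_u)x^{pu}$ and $\psi(G)=\sum_u\phi^{-1}(G_{pu})x^u$. For homogeneous $H\in\mathbf Z_q[x]$, $A_H=\psi\circ T_{H^{p-1}}$ where $T_{H^{p-1}}$ is multiplication by $H^{p-1}$; $A_H$ is $\phi^{-1}$-semilinear and maps $\mathbf Z_q[x]_k$ to itself for $H$ of degree $k$, so $A_H^{ar}$ is $\mathbf Z_q$-linear. $\mathbf T^n_{\mathbf F_q}=\{x_0\cdots x_n\ne0\}\subset\mathbf P^n_{\mathbf F_q}$ and $|X(\mathbf F_{q^r})|=\frac1{q^r-1}\#\{c\in(\mathbf F_{q^r}^* )^{n+1}:\bar F(c)=0\}$ ($\bar F=0$ allowed). *)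

(* Defs.v *)
From HB Require Import structures.
From mathcomp Require Import all_boot all_order all_algebra all_field.
Set Implicit Arguments. Unset Strict Implicit. Unset Printing Implicit Defensive.
Import GRing.Theory.
Local Open Scope ring_scope.

Definition expo (n : nat) := {ffun 'I_n.+1 -> nat}.
Definition edeg n (u : expo n) : nat := (\sum_i u i)%N.

(* A polynomial G in R[x_0..x_n] is given by its coefficient function u |-> G_u.
   (All polynomials built below have finite support.) *)
Definition hpoly (R : Type) (n : nat) := expo n -> R.

Definition homog (R : pzRingType) n k (G : hpoly R n) :=
  forall u : expo n, edeg u <> k -> G u = 0.

(* bounded exponent vectors, used to enumerate finite ranges of monomials *)
Definition bnd n k := {ffun 'I_n.+1 -> 'I_k.+1}.
Definition bexp n k (v : bnd n k) : expo n := [ffun i => nat_of_ord (v i)].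

Definition pmul (R : pzRingType) n (G H : hpoly R n) : hpoly R n := fun u =>
  \sum_(v : bnd n (edeg u) | [forall i, (v i <= u i)%N])
     G (bexp v) * H [ffun i => (u i - v i)%N].
Definition pone (R : pzRingType) (n : nat) : hpoly R n :=
  fun u => if edeg u == 0%N then 1 else 0.
Arguments pone R n u : clear implicits.
Definition ppow (R : pzRingType) n (G : hpoly R n) (s : nat) : hpoly R n :=
  iter s (pmul G) (pone R n).
Definition mono (R : pzRingType) n (w : expo n) : hpoly R n :=
  fun u => if u == w then 1 else 0.
Arguments mono R {n} w u.

Definition psiop (R : pzRingType) n (phiinv : R -> R) (p : nat) (G : hpoly R n)
  : hpoly R n := fun u => phiinv (G [ffun i => (p * u i)%N]).
Definition AH (R : pzRingType) n (phiinv : R -> R) (p : nat) (H : hpoly R n)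
  : hpoly R n -> hpoly R n := fun G => psiop phiinv p (pmul (ppow H (p - 1)) G).

Definition traceA (R : pzRingType) n (phiinv : R -> R) (p : nat) (H : hpoly R n)
  (k m : nat) : R :=
  \sum_(v : bnd n k | edeg (bexp v) == k)
     iter m (AH phiinv p H) (mono R (bexp v)) (bexp v).

Definition peval (K L : pzRingType) (iota : K -> L) n d (G : hpoly K n)
  (c : {ffun 'I_n.+1 -> L}) : L :=
  \sum_(v : bnd n d | edeg (bexp v) == d)
     iota (G (bexp v)) * \prod_i c i ^+ (v i).

Definition ntorus_zeros (K L : finFieldType) (iota : K -> L) n d (G : hpoly K n)
  : nat :=
  #|[set c : {ffun 'I_n.+1 -> L} | [forall i, c i != 0] && (peval iota d G c == 0)]|.

(* binomial coefficient binom(-l, t) = (-1)^t binom(l+t-1, t) *)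
Definition binomN (l t : nat) : int := (-1) ^+ t * ('C(l + t - 1, t))%:Z.
(* binom(l, j) for integer j = s - t (zero when j < 0) *)
Definition binomZ (l s t : nat) : int := if (t <= s)%N then ('C(l, s - t))%:Z else 0.
Definition alpha (lam tau s : nat) : int :=
  (-1) ^+ s * \sum_(t < tau) binomN lam t * binomZ lam s t.

Definition rdvd (R : pzRingType) (m x : R) := exists y, x = m * y.
Definition rcong (R : pzRingType) (m x y : R) := rdvd m (x - y).

(* R is (isomorphic to) the ring of Witt vectors Z_q of the finite field K,
   with reduction map pi : R -> K, characterized as a strict p-ring:
   pi surjective with kernel pR, p not a zero divisor, R p-adically
   separated and complete. *)
Definition is_Witt_ring (p : nat) (R : comNzRingType) (K : finFieldType)
  (pi : R -> K) :=
  [/\ forall y : K, exists x, pi x = y,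
      forall x, pi x = 0 <-> rdvd (p%:R : R) x,
      forall x : R, p%:R * x = 0 -> x = 0,
      forall x : R, (forall m, rdvd (p%:R ^+ m) x) -> x = 0 &
      forall xs : nat -> R, (forall m, rdvd (p%:R ^+ m) (xs m.+1 - xs m)) ->
        exists l, forall m, rdvd (p%:R ^+ m) (l - xs m)].

(* Main.v *)
Require Import Defs.
From HB Require Import structures.
From mathcomp Require Import all_boot all_order all_algebra all_field.
From mathcomp Require Import fingroup cyclic ring zify.
Import GRing.Theory.
Local Open Scope ring_scope.
Set Implicit Arguments. Unset Strict Implicit.

(* Put m = a r and P(y) = sum_s alpha_s y^s.  Then P(y) is (1 - y)^lambda times
   the truncation below y^tau of the power series (1 - y)^(-lambda), so that P(y)
   is 0 modulo p^lambda when y = 1 mod p, and 1 modulo p^lambda when y is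
   divisible by p^((p-1)m).  These are the two possible behaviours of
   y(c) = N(F(c))^(p-1), for c a Teichmuller lift of a torus point over F_(q^r)
   and N(z) the product of the z^(phi^i) for i < m, so the sum of the P(y(c)) over
   all c counts the zeros.  On the other hand y(c)^s is the value at c of the
   polynomial M_s, product of the (F^(s(p-1)))^(phi^i)(x^(p^i)) for i < m;
   orthogonality of characters turns its sum over c into (q^r-1)^(n+1) times the
   sum of the coefficients of M_s at the exponents (q^r-1)w, and
   A_(F^s)^m = psi^m o T_(M_s) identifies the latter sum with the trace, up to a
   twist by phi^(-m), which fixes all integers.

   Everything takes place modulo p^lambda in S = R[x]/(f), where f lifts the
   minimal polynomial of a generator of F_(q^r)^*; powers of arbitrary lifts are
   good enough approximations of the Teichmuller representatives. *)


(** * Congruences modulo powers of an element, in particular of p *)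

Section Congruence.

Variable S : comNzRingType.
Implicit Types m x y z : S.

Lemma rdvd0 m : rdvd m 0.
Proof. by exists 0; rewrite mulr0. Qed.

Lemma rdvdD m x y : rdvd m x -> rdvd m y -> rdvd m (x + y).
Proof. by move=> [u ->] [v ->]; exists (u + v); rewrite mulrDr. Qed.

Lemma rdvdN m x : rdvd m x -> rdvd m (- x).
Proof. by move=> [u ->]; exists (- u); rewrite mulrN. Qed.

Lemma rdvdMl m x y : rdvd m y -> rdvd m (x * y).
Proof. by move=> [u ->]; exists (x * u); rewrite mulrCA. Qed.

Lemma rdvdMM m1 m2 x y : rdvd m1 x -> rdvd m2 y -> rdvd (m1 * m2) (x * y).
Proof. by move=> [u ->] [v ->]; exists (u * v); rewrite mulrACA. Qed.

Lemma rdvdXX m x k : rdvd m x -> rdvd (m ^+ k) (x ^+ k).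
Proof. by move=> [u ->]; exists (u ^+ k); rewrite exprMn. Qed.

Lemma rdvdXl m x k l : (k <= l)%N -> rdvd (m ^+ l) x -> rdvd (m ^+ k) x.
Proof.
by move=> kl [u ->]; exists (m ^+ (l - k) * u); rewrite mulrA -exprD subnKC.
Qed.

Lemma rdvd_sum m (I : eqType) (r : seq I) (P : pred I) (F : I -> S) :
  (forall i, i \in r -> P i -> rdvd m (F i)) -> rdvd m (\sum_(i <- r | P i) F i).
Proof.
move=> Fm; rewrite big_seq_cond; elim/big_ind: _ => [|x y|i /andP[]].
- exact: rdvd0.
- exact: rdvdD.
- exact: Fm.
Qed.

Lemma rcong_refl m x : rcong m x x.
Proof. by rewrite /rcong subrr; apply: rdvd0. Qed.

Lemma rcong_sym m x y : rcong m x y -> rcong m y x.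
Proof. by rewrite /rcong => /rdvdN; rewrite opprB. Qed.

Lemma rcong_trans m y x z : rcong m x y -> rcong m y z -> rcong m x z.
Proof. by move=> xy yz; have := rdvdD xy yz; rewrite subrKA. Qed.

Lemma rcongM m x x' y y' : rcong m x x' -> rcong m y y' ->
  rcong m (x * y) (x' * y').
Proof.
move=> xx yy; rewrite /rcong.
have -> : x * y - x' * y' = y * (x - x') + x' * (y - y').
  by rewrite !mulrBr (mulrC y x) (mulrC y x') addrA subrK.
by apply: rdvdD; apply: rdvdMl.
Qed.

Lemma rcongX m x y k : rcong m x y -> rcong m (x ^+ k) (y ^+ k).
Proof.
move=> xy; elim: k => [|k IH]; first exact: rcong_refl.
by rewrite !exprS; apply: rcongM.
Qed.

Lemma rcong_sum m (I : eqType) (r : seq I) (P : pred I) (F G : I -> S) :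
  (forall i, i \in r -> P i -> rcong m (F i) (G i)) ->
  rcong m (\sum_(i <- r | P i) F i) (\sum_(i <- r | P i) G i).
Proof. by move=> FG; rewrite /rcong -sumrB; apply: rdvd_sum. Qed.

Lemma rcong_prod m (I : eqType) (r : seq I) (P : pred I) (F G : I -> S) :
  (forall i, i \in r -> P i -> rcong m (F i) (G i)) ->
  rcong m (\prod_(i <- r | P i) F i) (\prod_(i <- r | P i) G i).
Proof.
move=> FG; rewrite [X in rcong _ X _]big_seq_cond [X in rcong _ _ X]big_seq_cond.
elim/big_rec2: _ => [|i x y /andP[ri Pi] xy]; first exact: rcong_refl.
by apply: rcongM => //; apply: FG.
Qed.

(** Factor [x ^+ p - y ^+ p] through [x - y]. As [k > 0], [x] and [y] agree modulo p, so the
    cofactor is [p%:R * y ^+ p.-1] modulo p and supplies one more factor p. *)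
Lemma rcong_expp p x y k : prime p -> (0 < k)%N ->
  rcong (p%:R ^+ k) x y -> rcong (p%:R ^+ k.+1) (x ^+ p) (y ^+ p).
Proof.
move=> p_pr k_gt0 xy; rewrite /rcong subrXX.
have -> : p%:R ^+ k.+1 = p%:R ^+ k * p%:R :> S by rewrite exprSr.
apply: rdvdMM => //.
have xy1 : rcong (p%:R : S) x y by apply: (@rdvdXl _ _ 1 k).
have : rcong (p%:R : S) (\sum_(i < p) x ^+ (p.-1 - i) * y ^+ i)
   (\sum_(i < p) y ^+ p.-1).
  apply: rcong_sum => i _ _.
  have -> : y ^+ p.-1 = y ^+ (p.-1 - i) * y ^+ i.
    by rewrite -exprD subnK // -ltnS prednK ?prime_gt0.
  by apply: rcongM; [apply: rcongX | apply: rcong_refl].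
rewrite sumr_const card_ord /rcong -[y ^+ _ *+ p]mulr_natl => E.
rewrite -[X in rdvd _ X](subrK (p%:R * y ^+ p.-1)).
by apply: rdvdD => //; exists (y ^+ p.-1).
Qed.

Lemma rcong_exppX p x y k : prime p ->
  rcong p%:R x y -> rcong (p%:R ^+ k.+1) (x ^+ (p ^ k)) (y ^+ (p ^ k)).
Proof.
move=> p_pr xy; elim: k => [|k IH]; first by rewrite !expr1.
by rewrite expnSr !exprM; apply: rcong_expp.
Qed.

(** Iterating the hypothesis k times produces the factor [(m * v) ^+ k]. This serves to cancel a
    factor [1 - m * v] modulo [m ^+ k] without inverting it. *)
Lemma rdvd_bootstrap m v x k : rcong (m ^+ k) x (m * v * x) -> rdvd (m ^+ k) x.
Proof.
move=> xE; have H j : rcong (m ^+ k) x ((m * v) ^+ j * x).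
  elim: j => [|j IH]; first by rewrite mul1r; apply: rcong_refl.
  rewrite exprSr -mulrA; apply: rcong_trans IH _.
  by apply: rcongM xE; apply: rcong_refl.
have := H k; rewrite /rcong exprMn => E.
rewrite -(subrK (m ^+ k * v ^+ k * x) x); apply: rdvdD => //.
by exists (v ^+ k * x); rewrite mulrA.
Qed.

End Congruence.

Lemma rdvd_rmorph (S T : comNzRingType) (f : {rmorphism S -> T}) m x :
  rdvd m x -> rdvd (f m) (f x).
Proof. by move=> [u ->]; exists (f u); rewrite rmorphM. Qed.

(** * The polynomial P with coefficients [alpha] *)

Section TruncatedInverse.

Variable S : comNzRingType.
Implicit Type y : S.

(** The sum truncates the power series of (1 - y)^(-lam). By induction on [lam]: one factor [1 - y]
    lowers [lam] by one, at the cost of a single term in [y ^+ tau]. *)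
Lemma mul_negbinom_trunc lam tau y : (0 < tau)%N ->
  exists g, (1 - y) ^+ lam * \sum_(t < tau) 'C(lam + t - 1, t)%:R * y ^+ t
            = 1 + y ^+ tau * g.
Proof.
case: tau => // tau _; elim: lam => [|lam [g IH]].
  (* For [lam = 0] only [t = 0] contributes: truncated subtraction makes its binomial ['C(0, 0)],
     and ['C(t - 1, t)] vanishes for [t > 0]. *)
  exists 0; rewrite mul1r mulr0 addr0 big_ord_recl mulr1 big1 ?addr0 // => i _.
  by rewrite add0n bin_small ?mul0r //= /bump add1n subn1.
have E k : (1 - y) * \sum_(t < k.+1) 'C(lam.+1 + t - 1, t)%:R * y ^+ t =
   \sum_(t < k.+1) 'C(lam + t - 1, t)%:R * y ^+ t - 'C(lam + k, k)%:R * y ^+ k.+1.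
  elim: k => [|k IHk].
    by rewrite !big_ord_recl !big_ord0 !addr0 !bin0 !mul1r !mulr1 expr1.
  rewrite big_ord_recr /= mulrDr IHk [in RHS]big_ord_recr /=.
  rewrite (_ : lam.+1 + k.+1 - 1 = (lam + k).+1)%N; last by lia.
  rewrite (_ : lam + k.+1 - 1 = lam + k)%N; last by lia.
  rewrite (_ : lam + k.+1 = (lam + k).+1)%N; last by lia.
  by rewrite binS natrD ![y ^+ _.+1]exprS; ring.
exists (g - (1 - y) ^+ lam * 'C(lam + tau, tau)%:R).
rewrite exprSr -mulrA E mulrBr IH mulrBr addrA; congr (_ - _).
by rewrite mulrA [RHS]mulrC.
Qed.

(** [alpha] is a convolution of the coefficients (-1)^t C(-lam, t) = C(lam + t - 1, t) of the
    truncated series with those of (1 - y)^lam; the product has degree at most [lam + tau - 1]. *)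
Lemma sum_alphaE lam tau y :
  \sum_(s < lam + tau) (alpha lam tau s)%:~R * y ^+ s =
  (1 - y) ^+ lam * \sum_(t < tau) 'C(lam + t - 1, t)%:R * y ^+ t.
Proof.
have E s : (alpha lam tau s)%:~R * y ^+ s =
  \sum_(t < tau) (if (t <= s)%N then
     'C(lam + t - 1, t)%:R * y ^+ t * ('C(lam, s - t)%:R * (- y) ^+ (s - t)) else 0).
  rewrite /alpha mulr_sumr rmorph_sum mulr_suml; apply: eq_bigr => t _.
  rewrite /binomN /binomZ; case: leqP => ts; last by rewrite !mulr0 mul0r.
  rewrite !rmorphM /= !rmorphXn /= rmorphN1 -!pmulrn.
  rewrite -[s in RHS](subnK ts) addnK -[s in LHS](subnK ts) addnK.
  rewrite [(- y) ^+ _]exprNn !exprD.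
  have e1 : (-1) ^+ t * (-1) ^+ t = 1 :> S.
    by rewrite -exprD addnn -signr_odd odd_double.
  move: e1; set c := (-1) ^+ t; set b := (-1) ^+ _ => e1.
  set B := (_)%:R; set C := (_)%:R; set Y := y ^+ t; set Z := y ^+ _.
  by transitivity (c * c * (B * C * b * Y * Z)); [ring | rewrite e1; ring].
under eq_bigr do rewrite E.
rewrite exchange_big /= mulr_sumr; apply: eq_bigr => -[t tlt] _ /=.
rewrite -big_mkcond -mulr_sumr mulrC; congr (_ * _).
rewrite exprDn -(big_mkord (fun s => (t <= s)%N)
  (fun s => 'C(lam, s - t)%:R * (- y) ^+ (s - t))).
(* Only t <= s <= t + lam contributes: the guard kills the part below t, and after the shift by t
   the binomials kill the part above lam. *)
rewrite (big_cat_nat (n := t)) //=; last by lia.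
rewrite big_nat_cond big1 ?add0r; last by move=> i; lia.
rewrite -{1}[t]add0n big_addn (big_cat_nat (n := lam.+1)) //=; last by lia.
rewrite [X in _ + X]big_nat_cond [X in _ + X]big1 ?addr0; last first.
  by move=> i /andP[/andP[li _] _]; rewrite addnK bin_small ?mul0r.
rewrite big_mkord; apply: eq_big => [i|i _]; first by rewrite leq_addl.
by rewrite addnK expr1n mul1r mulr_natl.
Qed.

End TruncatedInverse.


(** * The unramified extension S of R with residue field L *)

Section MinimalPolynomial.

Variables (K L : finFieldType) (iota : {rmorphism K -> L}) (z : L).

(** Descent on the size from X^|L| - X, which vanishes at z. Polynomials over K of bounded size form
    a finite type, so the existence of a smaller one is decidable; a minimal one divides because
    remainders are smaller. *)
Lemma ex_min_poly : exists f : {poly K},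
  [/\ f \is monic, root (map_poly iota f) z
    & forall g : {poly K}, root (map_poly iota g) z -> f %| g].
Proof.
have ex_g : exists n, exists2 g : {poly K},
    g != 0 & root (map_poly iota g) z /\ size g = n.
  have nz : 'X^#|L| - 'X != 0 :> {poly K}.
    rewrite -size_poly_eq0 size_polyDl size_polyXn // size_polyN size_polyX ltnS.
    exact: finNzRing_gt1.
  eexists; exists ('X^#|L| - 'X) => //; split; last by [].
  by rewrite rootE rmorphB /= map_polyXn map_polyX !hornerE expf_card subrr.
have {ex_g} [n [g gnz [gz sg]]] := ex_g.
elim/ltn_ind: n => n IH in g gnz gz sg *.
have [/existsP[h /andP[hnz hz]]|noh] :=
  boolP [exists h : {poly_n.-1 K}, (polyn h != 0) && root (map_poly iota (polyn h)) z].
  apply: (IH (size (polyn h)) _ (polyn h)) => //.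
  rewrite (leq_ltn_trans (size_npoly h)) // prednK // -sg.
  by rewrite size_poly_gt0.
have lnz : lead_coef g != 0 by rewrite lead_coef_eq0.
exists ((lead_coef g)^-1 *: g); split.
- by rewrite monicE lead_coefZ mulVf.
- by rewrite map_polyZ rootZ // fmorph_eq0 invr_eq0.
move=> k kz; rewrite dvdpZl ?invr_eq0 //.
have sk : (size (k %% g)%R <= n.-1)%N.
  by rewrite -ltnS prednK ?ltn_modpN0 // -sg ?ltn_modpN0 // size_poly_gt0.
apply: contraNT noh => kg; apply/existsP; exists (NPoly sk) => /=; rewrite kg /=.
move: kz; rewrite {1}(divp_eq k g) rmorphD rmorphM /= !rootE !hornerE.
by rewrite (rootP gz) mulr0 add0r.
Qed.

End MinimalPolynomial.

Section QpolyEval.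

Variables (R L : comNzRingType) (ev : {rmorphism {poly R} -> L}) (h : {poly R}).
Hypothesis evh : ev (mk_monic h) = 0.

(** The map induced by [ev] on the quotient, whose elements are stored as reduced representatives;
    [evh] makes it multiplicative. *)
Definition qpoly_eval (s : {poly %/ h}) : L := ev s.

Lemma qpoly_eval_in q : qpoly_eval (in_qpoly h q) = ev q.
Proof.
rewrite {2}(Pdiv.RingMonic.rdivp_eq (monic_mk_monic h) q).
by rewrite rmorphD rmorphM /= evh mulr0 add0r.
Qed.

Lemma qpoly_eval_zmod : zmod_morphism qpoly_eval.
Proof. by move=> x y; rewrite /qpoly_eval /= rmorphB. Qed.

Lemma in_qpolyK (x : {poly %/ h}) : in_qpoly h x = x.
Proof. exact/val_inj/in_qpoly_small/size_mk_monic. Qed.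

Lemma qpoly_eval_monoid : monoid_morphism qpoly_eval.
Proof.
split; first by rewrite -(in_qpoly1 h) qpoly_eval_in rmorph1.
move=> x y; rewrite -{1}(in_qpolyK x) -{1}(in_qpolyK y) -in_qpolyM qpoly_eval_in.
exact: rmorphM.
Qed.

End QpolyEval.

Section Extension.

Variables (p : nat) (R : comNzRingType) (K L : finFieldType).
Variables (pi : {rmorphism R -> K}) (iota : {rmorphism K -> L}).
Hypothesis pi_surj : forall y, exists x, pi x = y.
Hypothesis pi_ker : forall x, pi x = 0 -> rdvd (p%:R : R) x.

Lemma lift_poly (g : {poly K}) :
  exists2 f : {poly R}, map_poly pi f = g & (size f <= size g)%N.
Proof.
have E y : exists x, pi x == y by have [x <-] := pi_surj y; exists x.
pose l y := xchoose (E y); exists (\poly_(i < size g) l g`_i); last exact: size_poly.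
apply/polyP => i; rewrite coef_map /= coef_poly; case: ltnP => [_|gi].
  exact: eqP (xchooseP (E g`_i)).
by rewrite rmorph0 nth_default.
Qed.

Lemma lift_monic (g : {poly K}) : g \is monic ->
  exists2 f : {poly R}, map_poly pi f = g & f \is monic.
Proof.
move=> g_mon; have [f fg fs] := lift_poly (g - 'X^((size g).-1)).
have sg : (0 < size g)%N by rewrite size_poly_gt0 monic_neq0.
have s1 : (size (g - 'X^((size g).-1))%R <= (size g).-1)%N.
  apply/leq_sizeP => j; rewrite leq_eqVlt => /predU1P[<-|lj].
    by rewrite coefB coefXn eqxx -lead_coefE (monicP g_mon) subrr.
  by rewrite coefB coefXn gtn_eqF // nth_default ?subrr // -(prednK sg).
exists ('X^((size g).-1) + f).
  by rewrite rmorphD /= map_polyXn fg addrC subrK.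
by rewrite monicE lead_coefDl ?lead_coefXn // size_polyXn ltnS (leq_trans fs).
Qed.

Lemma ker_map_poly (g : {poly R}) : map_poly pi g = 0 ->
  exists h, g = p%:R *: h.
Proof.
move=> g0.
(* The implication is boolean and holds for every x, so that [xchoose] applies to each coefficient;
   0 is a default value. *)
have E (x : R) : exists y, (pi x == 0) ==> (x == p%:R * y).
  case: eqP => [/pi_ker[y ->]|_]; last by exists 0.
  by exists y; apply/eqP.
exists (\poly_(i < size g) xchoose (E g`_i)); apply/polyP => i.
rewrite coefZ coef_poly; case: ltnP => gi; last by rewrite mulr0 nth_default.
have gi0 : pi g`_i == 0 by rewrite -coef_map g0 coef0.
exact: eqP (implyP (xchooseP (E g`_i)) gi0).
Qed.

(** Take [{poly %/ f}], with f a monic lift of the minimal polynomial of z, and evaluate at z. This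
    is onto since z generates the units of L, and its kernel is generated by p since an element
    vanishing at z is a multiple of f modulo p. *)
Lemma ex_unramified_extension :
  exists (S : comNzRingType) (j : {rmorphism R -> S}) (rho : {rmorphism S -> L}),
  [/\ forall y, exists s, rho s = y,
      forall s, rho s = 0 -> rdvd (p%:R : S) s,
      forall x, rho (j x) = iota (pi x)
    & forall N x, rdvd (p%:R ^+ N) (j x) -> rdvd (p%:R ^+ N) x].
Proof.
have [z z_gen] : exists z : L, forall y, y != 0 -> exists k, y = z ^+ k.
  have /cyclicP[u Lu] := field_unit_group_cyclic [set: {unit L}].
  exists (val u) => y; rewrite -unitfE => yU.
  have : FinRing.Unit yU \in [set: {unit L}] by rewrite inE.
  by rewrite Lu => /cycleP[k /(congr1 val)]; rewrite FinRing.val_unitX; exists k.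
have [fb [fb_mon fb_z fb_min]] := ex_min_poly iota z.
have [f f_fb f_mon] := lift_monic fb_mon.
pose ev : {rmorphism {poly R} -> L} :=
  horner_morph (fun a => mulrC z ((iota \o pi) a)).
have evE g : ev g = (map_poly iota (map_poly pi g)).[z].
  by rewrite -map_poly_comp.
have evf : ev f = 0 by rewrite evE f_fb (rootP fb_z).
(* [mk_monic] replaces a constant by X, so f = 1 must be excluded: it would not vanish at z. *)
have mkf : mk_monic f = f.
  rewrite /mk_monic f_mon andbT; case: ltnP => // sf1.
  move: f_mon evf; rewrite (size1_polyC sf1) monicE lead_coefC => /eqP->.
  by rewrite rmorph1 => /eqP; rewrite oner_eq0.
have ev0 : ev (mk_monic f) = 0 by rewrite mkf.
pose rho : {rmorphism {poly %/ f} -> L} := HB.pack (@qpoly_eval R L ev f)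
  (GRing.isZmodMorphism.Build _ _ _ (@qpoly_eval_zmod R L ev f))
  (GRing.isMonoidMorphism.Build _ _ _ (qpoly_eval_monoid ev0)).
exists {poly %/ f}, (qpolyC f), rho; split.
- move=> y; have [->|/z_gen[k ->]] := eqVneq y 0; first by exists 0; rewrite rmorph0.
  exists (in_qpoly f 'X^k); transitivity (ev 'X^k); first exact: qpoly_eval_in.
  by rewrite rmorphXn /ev /= horner_morphX.
- move=> s; rewrite /= /qpoly_eval evE => /eqP/fb_min.
  move=> /dvdpP[q sq].
  have [q' q'q _] := lift_poly q.
  have /ker_map_poly[h sh] : map_poly pi (polyn s - q' * f) = 0.
    by rewrite rmorphB rmorphM /= q'q f_fb sq subrr.
  exists (in_qpoly f h); rewrite -[s]in_qpolyK.
  have -> : polyn s = p%:R *: h + q' * f by rewrite -sh subrK.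
  rewrite in_qpolyD in_qpolyM in_qpolyZ.
  have -> : in_qpoly f f = 0.
    by apply/val_inj; rewrite /= -{1}mkf Pdiv.RingMonic.rmodpp ?monic_mk_monic.
  by rewrite mulr0 addr0 scaler_nat mulr_natl.
- by move=> x; rewrite /= /qpoly_eval /= evE !map_polyC /= hornerC.
(* Divisibility descends to R by comparing constant coefficients, since p^N acts coefficientwise. *)
- move=> N x [s]; rewrite -natrX mulr_natl => /(congr1 (fun s => (polyn s)`_0)).
  rewrite /= coefC /= raddfMn coefMn => ->; exists (polyn s)`_0.
  by rewrite -natrX mulr_natl.
Qed.

End Extension.


(** * Approximate Teichmuller representatives and orthogonality of characters *)

Lemma expf_card_pred (L : finFieldType) (x : L) : x != 0 -> x ^+ (#|L| - 1) = 1.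
Proof.
move=> x0; apply: (mulfI x0); rewrite mulr1 -exprS subn1 prednK ?expf_card //.
by apply/card_gt0P; exists x.
Qed.

(** Otherwise X^k' - 1, with k' the nonzero remainder of k, would have all [#|L| - 1] units as
    roots, more than its degree. *)
Lemma ex_expf_neq1 (L : finFieldType) k : ~~ (#|L| - 1 %| k)%N ->
  exists2 z : L, z != 0 & z ^+ k != 1.
Proof.
move=> ndk; pose k' := (k %% (#|L| - 1))%N.
have k'_gt0 : (0 < k')%N by rewrite lt0n.
have L1 : (0 < #|L| - 1)%N by rewrite subn_gt0 finNzRing_gt1.
have k'_lt : (k' < #|L| - 1)%N by rewrite ltn_mod.
have [/existsP[z /andP[z0 zk]]|] := boolP [exists z : L, (z != 0) && (z ^+ k != 1)].
  by exists z.
rewrite negb_exists => /forallP all1.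
pose P : {poly L} := 'X^k' - 1.
have nz : P != 0 by rewrite -size_poly_eq0 size_XnsubC.
have : (size (enum (predC1 (0%R : L))) < size P)%N.
  apply: max_poly_roots => //; last exact: enum_uniq.
  apply/allP => z; rewrite mem_enum inE => z0; rewrite rootE !hornerE.
  have := all1 z; rewrite z0 negbK {1}(divn_eq k (#|L| - 1)) exprD mulnC exprM.
  by rewrite expf_card_pred // expr1n mul1r => /eqP->; rewrite subrr.
by rewrite size_XnsubC // -cardE cardC1 ltnS leqNgt -subn1 k'_lt.
Qed.

Section ApproximateTeichmuller.

Variables (p m : nat) (S : comNzRingType) (L : finFieldType).
Variables (rho : {rmorphism S -> L}).
Hypothesis p_pr : prime p.
Hypothesis cardL : #|L| = (p ^ m)%N.
Hypothesis rho_surj : forall y : L, exists s, rho s == y.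
Hypothesis rho_ker : forall s, rho s = 0 -> rdvd (p%:R : S) s.
Variable N : nat.

Lemma pcharL : p \in [pchar L].
Proof. exact: card_finPcharP cardL p_pr. Qed.

Lemma rho_rcong x y : rho x = rho y -> rcong (p%:R : S) x y.
Proof. by move=> xy; apply: rho_ker; rewrite rmorphB /= xy subrr. Qed.

Lemma card_gt1_exp : (0 < m)%N.
Proof. by have := finNzRing_gt1 L; rewrite cardL; case: m. Qed.

(* The sequence of powers x ^ (#|L| ^ N) of a lift x of c converges to the
   Teichmuller representative of c; N steps are enough modulo p ^ N. *)
Definition teich (c : L) : S := xchoose (rho_surj c) ^+ (p ^ (m * N)).

Lemma rho_teich c : rho (teich c) = c.
Proof.
rewrite rmorphXn /= (eqP (xchooseP (rho_surj c))) expnM -cardL.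
elim: N => [|k IH]; first by rewrite expr1.
by rewrite expnS exprM expf_card.
Qed.

(** Modulo p^N, [teich c] thus does not depend on the lift of c; [m > 0] makes the exponent large
    enough. *)
Lemma rcong_teich (x y : S) : rcong p%:R x y ->
  rcong (p%:R ^+ N) (x ^+ (p ^ (m * N))) (y ^+ (p ^ (m * N))).
Proof.
move=> xy; apply: rdvdXl (rcong_exppX (m * N) p_pr xy).
by rewrite leqW // leq_pmull // card_gt1_exp.
Qed.

Lemma teichM x y : rcong (p%:R ^+ N) (teich (x * y)) (teich x * teich y).
Proof.
rewrite -exprMn; apply/rcong_teich/rho_rcong.
by rewrite rmorphM /= !(eqP (xchooseP (rho_surj _))).
Qed.

Lemma teich_unity c k : c != 0 -> (#|L| - 1 %| k)%N ->
  rcong (p%:R ^+ N) (teich c ^+ k) 1.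
Proof.
move=> c0 /dvdnP[l ->]; rewrite -exprM mulnA mulnC mulnA exprM exprM.
rewrite -[X in rcong _ _ X](expr1n _ l); apply: rcongX.
rewrite -[X in rcong _ _ X](expr1n _ (p ^ (m * N))).
apply/rcong_teich/rho_rcong.
by rewrite rmorphXn /= (eqP (xchooseP (rho_surj _))) rmorph1 expf_card_pred.
Qed.

(** If [#|L| - 1] does not divide k, choose z with z^k != 1. Multiplication by z permutes the units,
    so (teich(z)^k - 1) T vanishes modulo p^N, and the first factor is invertible modulo p. *)
Lemma sum_teich k : rcong (p%:R ^+ N) (\sum_(c | c != 0) teich c ^+ k)
  (if (#|L| - 1 %| k)%N then (#|L| - 1)%:R else 0).
Proof.
have [dk|ndk] := boolP (#|L| - 1 %| k)%N.
  have -> : (#|L| - 1)%:R = \sum_(c : L | c != 0) 1 :> S.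
    by rewrite sumr_const cardC1 subn1.
  by apply: rcong_sum => c _ c0; apply: teich_unity.
have [z z0 zk] := ex_expf_neq1 ndk.
set T := \sum_(c | _) _.
have zT : rcong (p%:R ^+ N) T (teich z ^+ k * T).
  rewrite {1}/T (reindex_inj (mulfI z0)) mulr_sumr.
  rewrite (eq_bigl (fun c : L => c != 0)); last first.
    by move=> c; rewrite mulf_eq0 negb_or z0.
  by apply: rcong_sum => c _ _; rewrite -exprMn; apply/rcongX/teichM.
(* [u] lifts the inverse of z^k - 1, so [u * (teich z ^+ k - 1)] has the form [1 - p%:R * v] that
   [rdvd_bootstrap] cancels. *)
have [u uz] := rho_surj (z ^+ k - 1)^-1.
have [v Ev] : rdvd (p%:R : S) (1 - u * (teich z ^+ k - 1)).
  apply: rho_ker; rewrite rmorphB rmorphM rmorphB rmorphXn /= rho_teich (eqP uz).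
  by rewrite rmorph1 mulVf ?subrr // subr_eq0.
rewrite /rcong subr0; apply: (rdvd_bootstrap (v := v)).
rewrite -Ev mulrBl mul1r /rcong.
have -> : T - (T - u * (teich z ^+ k - 1) * T) = (- u) * (T - teich z ^+ k * T).
  by ring.
exact: rdvdMl.
Qed.

Lemma sum_torus_teich n (u : expo n) :
  rcong (p%:R ^+ N)
    (\sum_(c : {ffun 'I_n.+1 -> L} | [forall i, c i != 0])
        \prod_i teich (c i) ^+ u i)
    (if [forall i, #|L| - 1 %| u i]%N then (#|L| - 1)%:R ^+ n.+1 else 0).
Proof.
have -> : \sum_(c : {ffun 'I_n.+1 -> L} | [forall i, c i != 0])
        \prod_i teich (c i) ^+ u i =
  \prod_i \sum_(y : L | y != 0) teich y ^+ u i.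
  rewrite bigA_distr_big; apply: eq_bigl => c.
  by apply/forallP/ffun_onP => h i; have := h i.
have -> : (if [forall i, #|L| - 1 %| u i]%N then (#|L| - 1)%:R ^+ n.+1 else 0) =
   \prod_(i < n.+1) (if (#|L| - 1 %| u i)%N then (#|L| - 1)%:R else 0) :> S.
  case: forallP => [h|/forallP].
    by rewrite -[in LHS](card_ord n.+1) -prodr_const; apply: eq_bigr => i _; rewrite h.
  rewrite negb_forall => /existsP[i hi].
  by rewrite (bigD1 i) //= (negPf hi) mul0r.
by apply: rcong_prod => i _ _; apply: sum_teich.
Qed.

End ApproximateTeichmuller.


(** * Exponent vectors and products of homogeneous polynomials *)

Lemma eq_big_support (V : nmodType) (I : eqType) (s1 s2 : seq I)
    (P1 P2 : pred I) (F : I -> V) : uniq s1 -> uniq s2 ->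
    (forall i, F i != 0 -> (i \in s1) && P1 i = (i \in s2) && P2 i) ->
  \sum_(i <- s1 | P1 i) F i = \sum_(i <- s2 | P2 i) F i.
Proof.
move=> u1 u2 sub.
have nz (s : seq I) (P : pred I) :
    \sum_(i <- s | P i) F i = \sum_(i <- [seq i <- s | P i && (F i != 0)]) F i.
  rewrite big_filter big_mkcondr; apply: eq_bigr => i _.
  by case: eqP.
rewrite (nz s1) (nz s2); apply/perm_big/uniq_perm; rewrite ?filter_uniq // => i.
rewrite !mem_filter ![_ && (i \in _)]andbC !andbA.
by case: eqVneq => [_|/sub]; rewrite ?andbF ?andbT.
Qed.

Section Exponents.

Variable n : nat.
Implicit Types u v w : expo n.

(** All boxes are sequences in the one type [expo n], so sums over different ranges can be compared
    by [eq_big_support]. *)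
Definition box (B : nat) : seq (expo n) := [seq bexp b | b <- enum {: bnd n B}].

Definition expo_le u v := [forall i, u i <= v i]%N.
Definition expo_sub u v : expo n := [ffun i => u i - v i]%N.
Definition expo_mul k u : expo n := [ffun i => k * u i]%N.
Definition expo_dvd k u := [forall i, k %| u i]%N.

Lemma mem_box B u : (u \in box B) = [forall i, u i <= B]%N.
Proof.
apply/mapP/forallP => [[v _ ->] i|h]; first by rewrite ffunE -ltnS.
exists [ffun i => inord (u i)]; first by rewrite mem_enum.
by apply/ffunP => i; rewrite !ffunE inordK // ltnS.
Qed.

Lemma uniq_box B : uniq (box B).
Proof.
rewrite map_inj_uniq ?enum_uniq // => v w /ffunP vw; apply/ffunP => i.
by apply/val_inj; have := vw i; rewrite !ffunE.
Qed.

Lemma sum_bnd (V : nmodType) B (P : pred (expo n)) (F : expo n -> V) :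
  \sum_(v : bnd n B | P (bexp v)) F (bexp v) = \sum_(u <- box B | P u) F u.
Proof. by rewrite big_map big_enum_cond. Qed.

Lemma expo_le_deg u i : (u i <= edeg u)%N.
Proof. by rewrite /edeg (bigD1 i) //= leq_addr. Qed.

Lemma box_deg B u : (edeg u <= B)%N -> u \in box B.
Proof.
by move=> uB; rewrite mem_box; apply/forallP => i; rewrite (leq_trans _ uB) ?expo_le_deg.
Qed.

Lemma edeg_mul k u : edeg (expo_mul k u) = (k * edeg u)%N.
Proof. by rewrite /edeg big_distrr; apply: eq_bigr => i _; rewrite ffunE. Qed.

Lemma edeg_sub u v : expo_le v u -> edeg u = (edeg v + edeg (expo_sub u v))%N.
Proof.
move=> /forallP vu; rewrite /edeg -big_split; apply: eq_bigr => i _.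
by rewrite /= ffunE subnKC.
Qed.

Lemma expo_mul_inj k : (0 < k)%N -> injective (expo_mul k).
Proof.
move=> k0 u v /ffunP uv; apply/ffunP => i; have /eqP := uv i.
by rewrite !ffunE eqn_pmul2l // => /eqP.
Qed.

Lemma expo_dvdP k u : reflect (exists v, u = expo_mul k v) (expo_dvd k u).
Proof.
apply: (iffP forallP) => [h|[v ->] i]; last by rewrite ffunE dvdn_mulr.
exists [ffun i => u i %/ k]%N; apply/ffunP => i.
by rewrite !ffunE mulnC divnK.
Qed.

Lemma expo_mul_sub k u v :
  expo_sub (expo_mul k u) (expo_mul k v) = expo_mul k (expo_sub u v).
Proof. by apply/ffunP => i; rewrite !ffunE mulnBr. Qed.

Lemma expo_le_mul k u v : (0 < k)%N ->
  expo_le (expo_mul k u) (expo_mul k v) = expo_le u v.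
Proof. by move=> k0; apply: eq_forallb => i; rewrite !ffunE leq_pmul2l. Qed.

Lemma expo_mulM k l u : expo_mul k (expo_mul l u) = expo_mul (k * l) u.
Proof. by apply/ffunP => i; rewrite !ffunE mulnA. Qed.

End Exponents.

Section HPoly.

Variables (R : comNzRingType) (n : nat).
Implicit Types (G H : hpoly R n) (u v w : expo n).

(** The range in [pmul] varies with u; a common box allows sums over u and v to be exchanged. *)
Lemma pmulE B G H u : u \in box n B ->
  pmul G H u = \sum_(v <- box n B | expo_le v u) G v * H (expo_sub u v).
Proof.
rewrite mem_box => /forallP uB.
have -> : pmul G H u =
    \sum_(v <- box n (edeg u) | expo_le v u) G v * H (expo_sub u v).
  rewrite -sum_bnd; apply: eq_big => [v|v _].
    by apply: eq_forallb => i; rewrite ffunE.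
  by congr (_ * H _); apply/ffunP => i; rewrite !ffunE.
apply: eq_big_support => [||v _]; rewrite ?uniq_box // !mem_box.
case vu : (expo_le v u); rewrite ?andbF ?andbT //; move/forallP: vu => vu.
by apply/forallP/forallP => _ i; apply: leq_trans (vu i) _; rewrite ?expo_le_deg.
Qed.

Lemma pmul_ext G G' H H' : G =1 G' -> H =1 H' -> pmul G H =1 pmul G' H'.
Proof. by move=> GG HH u; apply: eq_bigr => v _; rewrite GG HH. Qed.

Lemma homog_pmul k l G H : homog k G -> homog l H -> homog (k + l) (pmul G H).
Proof.
move=> Gk Hl u uk; rewrite (pmulE _ _ (box_deg (leqnn _))).
rewrite big1 // => v vu; have [vk|/eqP vk] := eqVneq (edeg v) k; last first.
  by rewrite Gk ?mul0r.
rewrite Hl ?mulr0 // => wl; apply: uk.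
by rewrite (edeg_sub vu) vk wl.
Qed.

Lemma homog_pone : homog 0 (pone R n).
Proof. by move=> u /eqP; rewrite /pone => /negPf->. Qed.

Lemma homog_ppow k s G : homog k G -> homog (k * s) (ppow G s).
Proof.
move=> Gk; elim: s => [|s IH]; first by rewrite muln0; apply: homog_pone.
by rewrite mulnS; apply: homog_pmul.
Qed.

(** This is the product [x^w G]. *)
Definition pshift w G : hpoly R n :=
  fun u => if expo_le w u then G (expo_sub u w) else 0.

Lemma pmul_shift w G H : pmul G (pshift w H) =1 pshift w (pmul G H).
Proof.
move=> u; rewrite (pmulE _ _ (box_deg (leqnn _))) /pshift.
case wu: (expo_le w u); last first.
  rewrite big1 // => v vu; case: ifP => [/forallP wuv|_]; last exact: mulr0.
  case/negP: (negbT wu); apply/forallP => i; apply: leq_trans (wuv i) _.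
  by rewrite ffunE leq_subr.
move/forallP: wu => wu.
rewrite (pmulE (B := edeg u)); last first.
  rewrite mem_box; apply/forallP => i; rewrite ffunE.
  exact: leq_trans (leq_subr _ _) (expo_le_deg _ _).
rewrite big_mkcond [RHS]big_mkcond; apply: eq_bigr => v _.
have -> : expo_le v (expo_sub u w) = expo_le v u && expo_le w (expo_sub u v).
  apply/forallP/andP => [h|[/forallP h1 /forallP h2] i].
    split; apply/forallP => i; have := h i; have := wu i; rewrite ?ffunE; lia.
  by have := h1 i; have := h2 i; have := wu i; rewrite !ffunE; lia.
case: (expo_le v u) => //=; case: (expo_le w _); last exact: mulr0.
by congr (_ * H _); apply/ffunP => i; rewrite !ffunE subnAC.
Qed.

Lemma mono_shift w : mono R w =1 pshift w (pone R n).
Proof.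
move=> u; rewrite /mono /pshift /pone.
have [->|uw] := eqVneq u w.
  have -> : expo_le w w by apply/forallP.
  by rewrite (_ : edeg _ = 0%N) ?eqxx // /edeg big1 // => i; rewrite ffunE subnn.
case wu: (expo_le w u) => //; case: eqP => // d0; case/eqP: uw; apply/ffunP => i.
have := expo_le_deg (expo_sub u w) i; rewrite d0 ffunE leqn0 subn_eq0 => uwi.
by apply/eqP; rewrite eqn_leq uwi; apply: (forallP wu).
Qed.

(* [inflate f k G] is the polynomial G^f(x^k), the f acting on coefficients. *)
Definition inflate (f : R -> R) k G : hpoly R n := fun u =>
  if expo_dvd k u then f (G [ffun i => u i %/ k]%N) else 0.

Lemma inflate_mul f k G u : (0 < k)%N -> inflate f k G (expo_mul k u) = f (G u).
Proof.
move=> k0; rewrite /inflate; have -> : expo_dvd k (expo_mul k u).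
  by apply/expo_dvdP; exists u.
by congr (f (G _)); apply/ffunP => i; rewrite !ffunE mulKn.
Qed.

Lemma homog_inflate (f : R -> R) k l G : f 0 = 0 -> (0 < k)%N ->
  homog l G -> homog (k * l) (inflate f k G).
Proof.
move=> f0 k0 Gl u ul; rewrite /inflate; case: expo_dvdP => // -[v uv].
rewrite (_ : [ffun _ => _] = v); last first.
  by apply/ffunP => i; rewrite uv !ffunE mulKn.
by rewrite Gl ?f0 // => vl; apply: ul; rewrite uv edeg_mul vl.
Qed.

Lemma sum_inflate (V : nmodType) (F : expo n -> V) k B : (0 < k)%N ->
  (forall u, ~~ expo_dvd k u -> F u = 0) ->
  (forall u, F u != 0 -> u \in box n (k * B)) ->
  \sum_(u <- box n (k * B)) F u = \sum_(u <- box n B) F (expo_mul k u).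
Proof.
move=> k0 Fk FB; rewrite -(big_map (expo_mul k) xpredT F).
apply: eq_big_support => [||u Fu]; first exact: uniq_box.
  by rewrite map_inj_uniq ?uniq_box //; apply: expo_mul_inj.
rewrite !andbT FB //; case: (boolP (expo_dvd k u)) => [/expo_dvdP[v uv]|/Fk Fu0].
  have := FB u Fu; rewrite uv mem_map; last exact: expo_mul_inj.
  rewrite !mem_box => /forallP h; symmetry; apply/forallP => i.
  by have := h i; rewrite ffunE leq_pmul2l.
by rewrite Fu0 eqxx in Fu.
Qed.

Lemma pmul_inflate (f : R -> R) k G H u : (0 < k)%N ->
  pmul (inflate f k G) H (expo_mul k u) =
  \sum_(v <- box n (edeg u) | expo_le v u) f (G v) * H (expo_mul k (expo_sub u v)).
Proof.
move=> k0; rewrite (pmulE (B := (k * edeg u)%N)); last first.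
  by rewrite box_deg // edeg_mul.
rewrite big_mkcond sum_inflate //= => [|v nkv|v].
- rewrite [RHS]big_mkcond; apply: eq_bigr => v _.
  by rewrite expo_le_mul // inflate_mul // expo_mul_sub.
- by rewrite /inflate (negPf nkv) mul0r; case: ifP.
- case: ifP => [vu _|]; last by rewrite eqxx.
  by rewrite box_deg // -edeg_mul (edeg_sub vu) leq_addr.
Qed.

(** * Iterates of [AH] and their traces *)

Section CartierIterates.

Variables (p : nat) (phi phiinv : {rmorphism R -> R}).
Hypothesis p_gt0 : (0 < p)%N.
Hypothesis phiK : cancel phi phiinv.

(** The product of G and the H^(phi^i)(x^(p^i)) for i < j. *)
Fixpoint frob_prod (H : hpoly R n) j G : hpoly R n :=
  if j is j'.+1 then pmul (inflate (iter j' phi) (p ^ j') H) (frob_prod H j' G)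
  else G.

Lemma iter_phiinv_sum j (I : Type) (r : seq I) (P : pred I) (F : I -> R) :
  iter j phiinv (\sum_(i <- r | P i) F i) = \sum_(i <- r | P i) iter j phiinv (F i).
Proof. by elim: j => //= j ->; rewrite rmorph_sum. Qed.

Lemma iter_phiinvM j x y : iter j phiinv (x * y) = iter j phiinv x * iter j phiinv y.
Proof. by elim: j => //= j ->; rewrite rmorphM. Qed.

Lemma iter_phiK j : cancel (iter j phi) (iter j phiinv).
Proof. by elim: j => // j IH x; rewrite iterSr iterS phiK IH. Qed.

(* psi o T_(phi(G)) = T_G o psi moves all the psi's of an iterate to the left. *)
Lemma iter_AH H j G u :
  iter j (AH phiinv p H) G u =
  iter j phiinv (frob_prod (ppow H (p - 1)) j G (expo_mul (p ^ j) u)).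
Proof.
elim: j u => [|j IH] u.
  by congr G; apply/ffunP => i; rewrite ffunE mul1n.
have AHE D : AH phiinv p H D u = phiinv (pmul (ppow H (p - 1)) D (expo_mul p u)).
  by [].
rewrite iterS AHE [RHS]iterS; congr (phiinv _).
(* The new factor is inflated by p^j, so at the exponent p^j (p u) only multiples of p^j contribute,
   and its twist by phi^j cancels against [iter j phiinv]. *)
rewrite expnSr -expo_mulM /= pmul_inflate ?expn_gt0 ?p_gt0 //.
rewrite (pmulE _ _ (box_deg (leqnn _))) iter_phiinv_sum; apply: eq_bigr => v _.
by rewrite iter_phiinvM iter_phiK IH.
Qed.

Lemma frob_prod_ext H j G G' : G =1 G' -> frob_prod H j G =1 frob_prod H j G'.
Proof. by move=> GG; elim: j => //= j IH; apply: pmul_ext. Qed.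

Lemma frob_prod_shift H j w G :
  frob_prod H j (pshift w G) =1 pshift w (frob_prod H j G).
Proof.
by elim: j => //= j IH u; rewrite -pmul_shift; apply: pmul_ext => // v.
Qed.

(** The diagonal entry at x^w is, up to the twist, the coefficient of M x^w at p^m w, with M the
    Frobenius product; that is the coefficient of M at (p^m - 1) w. *)
Lemma traceAE H k m : traceA phiinv p H k m =
  iter m phiinv (\sum_(w <- box n k | edeg w == k)
    frob_prod (ppow H (p - 1)) m (pone R n) (expo_mul (p ^ m - 1) w)).
Proof.
rewrite /traceA (sum_bnd k (fun w => edeg w == k)
  (fun w => iter m (AH phiinv p H) (mono R w) w)).
rewrite iter_phiinv_sum; apply: eq_bigr => w _; rewrite iter_AH.
congr (iter m phiinv _); rewrite (frob_prod_ext _ _ (mono_shift w)).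
rewrite frob_prod_shift /pshift.
have -> : expo_le w (expo_mul (p ^ m) w).
  by apply/forallP => i; rewrite ffunE leq_pmull // expn_gt0 p_gt0.
by congr (_ _); apply/ffunP => i; rewrite !ffunE mulnBl mul1n.
Qed.

End CartierIterates.

End HPoly.

(** * Evaluation of homogeneous polynomials and of Frobenius products *)

Section Evaluation.

Variables (R S : comNzRingType) (n : nat).
Implicit Types (f : {rmorphism R -> S}) (G H : hpoly R n) (c : 'I_n.+1 -> S).

Definition emon c (u : expo n) : S := \prod_i c i ^+ u i.

(** The value at c of G with coefficients mapped by f; k only bounds the exponents, and any k at
    least the degree gives the same value. *)
Definition hev f k G c : S := \sum_(u <- box n k) f (G u) * emon c u.

Lemma hev_widen f k l G c : homog k G -> (k <= l)%N -> hev f l G c = hev f k G c.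
Proof.
move=> Gk kl; apply: eq_big_support; rewrite ?uniq_box // => u.
have [uk _|/eqP uk] := eqVneq (edeg u) k; last by rewrite Gk // rmorph0 mul0r eqxx.
by rewrite !box_deg ?uk.
Qed.

Lemma emon_sub c u v : expo_le v u -> emon c u = emon c v * emon c (expo_sub u v).
Proof.
move=> /forallP vu; rewrite /emon -big_split; apply: eq_bigr => i _ /=.
by rewrite -exprD ffunE subnKC.
Qed.

Lemma hev_pmul f k l G H c : homog k G -> homog l H ->
  hev f (k + l) (pmul G H) c = hev f k G c * hev f l H c.
Proof.
move=> Gk Hl; rewrite -(hev_widen f c Gk (leq_addr l k)) /hev.
transitivity (\sum_(u <- box n (k + l)) \sum_(v <- box n (k + l) | expo_le v u)
    f (G v) * emon c v * (f (H (expo_sub u v)) * emon c (expo_sub u v))).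
  rewrite !big_seq; apply: eq_bigr => u ub.
  rewrite (pmulE _ _ ub) rmorph_sum mulr_suml; apply: eq_bigr => v vu /=.
  by rewrite rmorphM /= (emon_sub _ vu); ring.
under eq_bigr do rewrite big_mkcond.
rewrite exchange_big mulr_suml /=; apply: eq_bigr => v _.
have [->|Gv] := eqVneq (G v) 0.
  by rewrite rmorph0 !mul0r big1 // => u _; case: ifP => _; rewrite ?mul0r.
(* Knowing the degree of v keeps v + w in the box of size k + l when w has degree l. *)
have vk : edeg v = k by apply/eqP; apply: contraR Gv => /eqP/Gk->.
pose add (w : expo n) : expo n := [ffun i => v i + w i]%N.
rewrite -big_mkcond mulr_sumr.
have addK w : expo_sub (add w) v = w by apply/ffunP => i; rewrite !ffunE addKn.
have v_add w : expo_le v (add w) by apply/forallP => i; rewrite ffunE leq_addr.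
have subK u : expo_le v u -> add (expo_sub u v) = u.
  by move=> /forallP vu; apply/ffunP => i; rewrite !ffunE subnKC.
rewrite -(eq_bigr _ (fun w _ => congr1
  (fun w => f (G v) * emon c v * (f (H w) * emon c w)) (addK w))).
rewrite -(big_map add xpredT (fun u => f (G v) * emon c v *
   (f (H (expo_sub u v)) * emon c (expo_sub u v)))).
have add_inj : injective add.
  by move=> w1 w2 /(congr1 (fun u => expo_sub u v)); rewrite !addK.
apply: eq_big_support => [||u Hu]; first exact: uniq_box.
  by rewrite map_inj_uniq ?uniq_box.
rewrite andbT; case vu: (expo_le v u); rewrite ?andbF ?andbT; last first.
  by symmetry; apply/negbTE/mapP => -[w _ uw]; rewrite uw v_add in vu.
(* In the substitution u = v + w, homogeneity of H makes the two ranges agree on nonzero terms. *)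
have ul : edeg (expo_sub u v) = l.
  by apply/eqP; apply: contraR Hu => /eqP/Hl->; rewrite rmorph0 mul0r mulr0.
rewrite box_deg; last by rewrite (edeg_sub vu) vk ul.
by rewrite -(subK _ vu) map_f // box_deg // ul.
Qed.

Lemma hev_pone f c : hev f 0 (pone R n) c = 1.
Proof.
pose z : expo n := [ffun=> 0%N].
have zd : edeg z = 0%N by rewrite /edeg big1 // => i _; rewrite ffunE.
rewrite /hev (eq_big_support (s2 := [:: z]) (P2 := xpredT)) ?uniq_box //.
  by rewrite big_seq1 /pone zd rmorph1 mul1r /emon big1 // => i _; rewrite ffunE.
move=> u _; rewrite !andbT inE mem_box; apply/forallP/eqP => [h|-> i].
  by apply/ffunP => i; have := h i; rewrite leqn0 ffunE => /eqP.
by rewrite ffunE.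
Qed.

Lemma hev_ppow f k s G c : homog k G -> hev f (k * s) (ppow G s) c = hev f k G c ^+ s.
Proof.
move=> Gk; elim: s => [|s IH]; first by rewrite muln0 hev_pone.
by rewrite mulnS exprS -IH; apply: hev_pmul => //; apply: homog_ppow.
Qed.

Lemma hev_inflate f (g : R -> R) (fg : {rmorphism R -> S}) k l G c :
  g 0 = 0 -> (0 < k)%N -> homog l G -> fg =1 f \o g ->
  hev f (k * l) (inflate g k G) c = hev fg l G (fun i => c i ^+ k).
Proof.
move=> g0 k0 Gl fgE; rewrite /hev sum_inflate //.
- apply: eq_bigr => u _; rewrite inflate_mul // fgE; congr (_ * _).
  by apply: eq_bigr => i _; rewrite ffunE exprM.
- by move=> u nu; rewrite /inflate (negPf nu) rmorph0 mul0r.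
move=> u; have [ul _|/eqP ul] := eqVneq (edeg u) (k * l)%N; first by rewrite box_deg ?ul.
by rewrite (homog_inflate g0 k0 Gl) // rmorph0 mul0r eqxx.
Qed.

End Evaluation.


Section IteratedMorphism.

Variables (R : comNzRingType) (phi : {rmorphism R -> R}).

(** [iter i phi] bundled as a morphism, as [hev] requires of its coefficient map. *)
Fixpoint rmorph_iter i : {rmorphism R -> R} :=
  if i is i'.+1 then GRing.RMorphism.clone _ _ (phi \o rmorph_iter i') _
  else GRing.RMorphism.clone _ _ idfun _.

Lemma rmorph_iterE i : rmorph_iter i =1 iter i phi.
Proof. by elim: i => //= i IH x; apply: congr1 (IH x). Qed.

Lemma iter_rmorph0 i : iter i phi 0 = 0.
Proof. by rewrite -rmorph_iterE rmorph0. Qed.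

End IteratedMorphism.

Section FrobProd.

Variables (R S : comNzRingType) (n p : nat) (phi : {rmorphism R -> R}).
Variables (f : {rmorphism R -> S}) (H : hpoly R n) (e : nat).
Hypothesis p_gt0 : (0 < p)%N.
Hypothesis He : homog e H.

Lemma homog_frob_prod m :
  homog (\sum_(i < m) p ^ i * e) (frob_prod p phi H m (pone R n)).
Proof.
elim: m => [|m IH]; first by rewrite big_ord0; apply: homog_pone.
rewrite big_ord_recr /= addnC; apply: homog_pmul => //.
by apply: homog_inflate; rewrite ?iter_rmorph0 ?expn_gt0 ?p_gt0.
Qed.

Lemma hev_frob_prod m c :
  hev f (\sum_(i < m) p ^ i * e) (frob_prod p phi H m (pone R n)) c =
  \prod_(i < m) hev (f \o rmorph_iter phi i) e H (fun t => c t ^+ (p ^ i)).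
Proof.
elim: m => [|m IH]; first by rewrite !big_ord0 hev_pone.
rewrite !big_ord_recr /= addnC hev_pmul; last exact: homog_frob_prod.
  rewrite IH mulrC; congr (_ * _); apply: hev_inflate => //.
  - exact: iter_rmorph0.
  - by rewrite expn_gt0 p_gt0.
  by move=> x; rewrite /= rmorph_iterE.
by apply: homog_inflate; rewrite ?iter_rmorph0 ?expn_gt0 ?p_gt0.
Qed.

End FrobProd.

(** * Zeros on the torus and their scaling *)

Section TorusPoints.

Variables (K L : finFieldType) (iota : {rmorphism K -> L}).
Variables (n d : nat) (G : hpoly K n).
Lemma pevalE (c : {ffun 'I_n.+1 -> L}) : homog d G -> peval iota d G c = hev iota d G c.
Proof.
move=> Gd; rewrite /peval /hev.
transitivity (\sum_(v : bnd n d | edeg (bexp v) == d)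
    iota (G (bexp v)) * emon c (bexp v)).
  apply: eq_bigr => v _; congr (_ * _); apply: eq_bigr => i _.
  by rewrite ffunE.
rewrite (sum_bnd d (fun u => edeg u == d) (fun u => iota (G u) * emon c u)).
rewrite big_mkcond; apply: eq_bigr => u _; case: eqP => // ud.
by rewrite Gd // rmorph0 mul0r.
Qed.

Lemma peval_scale y (c : {ffun 'I_n.+1 -> L}) :
  peval iota d G [ffun i => y * c i] = y ^+ d * peval iota d G c.
Proof.
rewrite /peval mulr_sumr; apply: eq_bigr => v /eqP vd.
rewrite mulrCA; congr (_ * _).
have -> : y ^+ d = \prod_i y ^+ v i.
  by rewrite prodrXr -[in LHS]vd; congr (_ ^+ _); apply: eq_bigr => i _; rewrite ffunE.
by rewrite -big_split; apply: eq_bigr => i _; rewrite !ffunE exprMn.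
Qed.

(** Scaling by y carries the zeros with first coordinate 1 onto those with first coordinate y, so
    the [#|L| - 1] fibres have equal size. The division in the count of projective points is
    therefore exact. *)
Lemma dvd_ntorus_zeros : (#|L| - 1 %| ntorus_zeros iota d G)%N.
Proof.
rewrite /ntorus_zeros; set A := [set c | _].
have A_scale y (c : {ffun 'I_n.+1 -> L}) : y != 0 ->
    ([ffun i => y * c i] \in A) = (c \in A).
  move=> y0; rewrite !inE peval_scale mulf_eq0 expf_eq0 (negPf y0) andbF /=.
  by congr (_ && _); apply: eq_forallb => i; rewrite ffunE mulf_eq0 (negPf y0).
rewrite -sum1_card.
rewrite (partition_big (fun c : {ffun 'I_n.+1 -> L} => c ord0) (predC1 0)) /=;
  last first.
  by move=> c; rewrite inE => /andP[/forallP].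
rewrite (eq_bigr (fun=> \sum_(c in A | c ord0 == 1%R) 1)%N); last first.
  move=> y y0.
  have h_inj : injective (fun c : {ffun 'I_n.+1 -> L} => [ffun i => y * c i]).
    move=> c1 c2 /ffunP c12; apply/ffunP => i; have := c12 i; rewrite !ffunE.
    exact: mulfI.
  rewrite (reindex_inj h_inj); apply: eq_bigl => c.
  rewrite A_scale // ffunE; congr (_ && _).
  by rewrite -{2}[y]mulr1 (inj_eq (mulfI y0)).
by rewrite sum_nat_const cardC1 subn1 dvdn_mulr.
Qed.

End TorusPoints.

(** * The count of zeros as a sum of traces, modulo p^lam in S *)

Section TraceFormula.

Variables (p m n d lam tau : nat) (R S : comNzRingType) (K L : finFieldType).
Variables (pi : {rmorphism R -> K}) (iota : {rmorphism K -> L}).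
Variables (phi : {rmorphism R -> R}).
Variables (j : {rmorphism R -> S}) (rho : {rmorphism S -> L}).
Variables (Fb : hpoly K n) (F : hpoly R n).
Hypothesis p_pr : prime p.
Hypothesis cardL : #|L| = (p ^ m)%N.
Hypothesis phi_frob : forall x, pi (phi x) = pi x ^+ p.
Hypothesis rho_surj : forall y : L, exists s, rho s == y.
Hypothesis rho_ker : forall s, rho s = 0 -> rdvd (p%:R : S) s.
Hypothesis rho_j : forall x, rho (j x) = iota (pi x).
Hypothesis Fd : homog d F.
Hypothesis F_lift : forall u, pi (F u) = Fb u.
Hypothesis tau_gt0 : (0 < tau)%N.
Hypothesis lam_le : (lam <= (p - 1) * m * tau)%N.

Let p_gt0 : (0 < p)%N := prime_gt0 p_pr.

Let Fbd : homog d Fb.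
Proof. by move=> u ud; rewrite -F_lift Fd // rmorph0. Qed.

(* At a vector c of Teichmuller representatives, raising to the power p is the
   Frobenius, and this product is the norm of F(c). *)
Definition norm_ev (c : 'I_n.+1 -> S) : S :=
  \prod_(i < m) hev (j \o rmorph_iter phi i) d F (fun t => c t ^+ (p ^ i)).

(** On residues [phi] is the p-th power map, so every coefficient and every monomial becomes a
    p^i-th power, and raising to p^i is additive in L. *)
Lemma rho_hev i (c : {ffun 'I_n.+1 -> L}) (ch : 'I_n.+1 -> S) :
    (forall t, rho (ch t) = c t) ->
  rho (hev (j \o rmorph_iter phi i) d F (fun t => ch t ^+ (p ^ i))) =
  peval iota d Fb c ^+ (p ^ i).
Proof.
move=> chc; rewrite (pevalE iota c Fbd) /hev rmorph_sum.
have expD : {morph (fun x : L => x ^+ (p ^ i)) : x y / x + y}.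
  move=> x y; apply: exprDn_pchar; apply/pnatP => [|l l_pr].
    by rewrite expn_gt0 p_gt0.
  rewrite (Euclid_dvdX _ _ l_pr) => /andP[]; rewrite dvdn_prime2 // => /eqP-> _.
  exact: pcharL p_pr cardL.
rewrite (big_morph _ expD (id1 := 0)); last by rewrite expr0n expn_eq0 eqn0Ngt p_gt0.
apply: eq_bigr => u _; rewrite rmorphM exprMn /= rho_j; congr (_ * _).
  rewrite -F_lift rmorph_iterE -rmorphXn; congr (iota _).
  elim: i {expD} => [|i IH]; first by rewrite expr1.
  by rewrite iterS phi_frob IH expnSr exprM.
rewrite /emon rmorph_prod -prodrXl; apply: eq_bigr => t _.
by rewrite !rmorphXn /= chc -!exprM mulnC.
Qed.

(* The power norm_ev ch ^+ (p - 1) is divisible by p ^+ ((p - 1) * m) when c is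
   a zero of Fb, and congruent to 1 modulo p otherwise. *)
Lemma alpha_indicator (c : {ffun 'I_n.+1 -> L}) (ch : 'I_n.+1 -> S) :
    (forall t, rho (ch t) = c t) ->
  rcong (p%:R ^+ lam)
    (\sum_(s < lam + tau) (alpha lam tau s)%:~R * norm_ev ch ^+ ((p - 1) * s))
    (if peval iota d Fb c == 0 then 1 else 0).
Proof.
move=> chc; under eq_bigr do rewrite exprM.
rewrite sum_alphaE.
case: eqP => [c0|/eqP c0].
  have [g ->] := mul_negbinom_trunc lam (norm_ev ch ^+ (p - 1)) tau_gt0.
  rewrite /rcong addrAC subrr add0r mulrC; apply: rdvdMl.
  apply: (rdvdXl lam_le); rewrite -mulnA [((p - 1) * _)%N]mulnC -mulnA.
  rewrite exprM mulnC exprM; apply/rdvdXX.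
  have : rdvd (\prod_(i < m) p%:R : S) (norm_ev ch).
    rewrite /norm_ev; elim/big_rec2: _ => [|i x y _]; first by exists 1; rewrite mulr1.
    move=> xy; apply: rdvdMM => //; apply: rho_ker.
    by rewrite (rho_hev _ chc) c0 expr0n expn_eq0 eqn0Ngt p_gt0.
  by rewrite prodr_const card_ord => /(rdvdXX (p - 1)).
rewrite /rcong subr0 mulrC; apply/rdvdMl/rdvdXX/rho_ker.
rewrite rmorphB rmorph1 rmorphXn /= rmorph_prod.
under eq_bigr do rewrite (rho_hev _ chc).
(* The norm reduces to the value of [Fb] to the power 1 + p + ... + p^(m-1), and p - 1 times this
   exponent is [#|L| - 1]. *)
rewrite prodrXr -exprM mulnC subn1 -predn_exp -subn1 -cardL.
by rewrite expf_card_pred ?subrr.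
Qed.

(** The polynomial M_s. *)
Definition frobF s : hpoly R n :=
  frob_prod p phi (ppow (ppow F s) (p - 1)) m (pone R n).

Lemma frobF_deg s : (\sum_(i < m) p ^ i * (d * s * (p - 1)) = (#|L| - 1) * (d * s))%N.
Proof.
rewrite -big_distrl /= cardL [in RHS]subn1 predn_exp -subn1.
by rewrite mulnCA mulnC; congr (_ * _)%N; apply: mulnC.
Qed.

Lemma homog_frobF s : homog ((#|L| - 1) * (d * s)) (frobF s).
Proof.
rewrite -frobF_deg; apply: homog_frob_prod => //.
exact/homog_ppow/homog_ppow.
Qed.

Lemma hev_frobF s c :
  hev j ((#|L| - 1) * (d * s)) (frobF s) c = norm_ev c ^+ ((p - 1) * s).
Proof.
rewrite -frobF_deg hev_frob_prod //; last exact/homog_ppow/homog_ppow.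
rewrite -prodrXl; apply: eq_bigr => i _.
by rewrite !hev_ppow //; [rewrite -exprM mulnC | apply: homog_ppow].
Qed.

(** By [traceAE], the trace for F^s before the twist by phi^(-m). *)
Definition frob_trace s : R :=
  \sum_(w <- box n (d * s) | edeg w == (d * s)%N) frobF s (expo_mul (#|L| - 1) w).

Let tch := teich p m rho_surj lam.

(** Expand in monomials and sum over c first: only exponents u = (|L| - 1) w survive, and
    homogeneity of M_s forces w to have degree [d * s]. *)
Lemma sum_norm_ev s :
  rcong (p%:R ^+ lam)
    (\sum_(c : {ffun 'I_n.+1 -> L} | [forall i, c i != 0])
       norm_ev (fun i => tch (c i)) ^+ ((p - 1) * s))
    ((#|L| - 1)%:R ^+ n.+1 * j (frob_trace s)).
Proof.
have L1 : (0 < #|L| - 1)%N by rewrite subn_gt0 finNzRing_gt1.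
have frobF0 u : edeg u <> ((#|L| - 1) * (d * s))%N -> frobF s u = 0.
  exact: homog_frobF.
under eq_bigr do rewrite -hev_frobF.
rewrite exchange_big /=.
have -> : (#|L| - 1)%:R ^+ n.+1 * j (frob_trace s) =
    \sum_(u <- box n ((#|L| - 1) * (d * s))) j (frobF s u) *
      (if expo_dvd (#|L| - 1) u then (#|L| - 1)%:R ^+ n.+1 else 0).
  rewrite sum_inflate //.
  - rewrite rmorph_sum mulr_sumr big_mkcond; apply: eq_bigr => w _.
    have -> : expo_dvd (#|L| - 1) (expo_mul (#|L| - 1) w).
      by apply/expo_dvdP; exists w.
    case: eqP => [_|wd]; first by rewrite mulrC.
    rewrite frobF0 ?rmorph0 ?mul0r // edeg_mul => /eqP.
    by rewrite eqn_pmul2l // => /eqP.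
  - by move=> u /negPf->; rewrite mulr0.
  move=> u; have [ud _|/eqP ud] := eqVneq (edeg u) ((#|L| - 1) * (d * s))%N.
    by rewrite box_deg ?ud.
  by rewrite frobF0 // rmorph0 mul0r eqxx.
apply: rcong_sum => u _ _; rewrite -mulr_sumr.
apply: rcongM (rcong_refl _ _) _.
exact: sum_torus_teich p_pr cardL rho_surj rho_ker lam n u.
Qed.

(** Sum [alpha_indicator] over the torus, exchange the sums over s and c, and insert
    [sum_norm_ev]. *)
Lemma torus_zeros_rcong :
  rcong (p%:R ^+ lam : S) (ntorus_zeros iota d Fb)%:R
    (j ((#|L| - 1)%:R ^+ n.+1 *
        \sum_(s < lam + tau) (alpha lam tau s)%:~R * frob_trace s)).
Proof.
have -> : (ntorus_zeros iota d Fb)%:R =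
    \sum_(c : {ffun 'I_n.+1 -> L} | [forall i, c i != 0])
      (if peval iota d Fb c == 0 then 1 else 0) :> S.
  rewrite -big_mkcondr /ntorus_zeros -sum1_card natr_sum.
  by apply: eq_bigl => c; rewrite inE.
apply: rcong_sym; rewrite rmorphM rmorphXn rmorph_nat rmorph_sum mulr_sumr /=.
apply: (rcong_trans (y := \sum_(s < lam + tau) (alpha lam tau s)%:~R *
   \sum_(c : {ffun 'I_n.+1 -> L} | [forall i, c i != 0])
       norm_ev (fun i => tch (c i)) ^+ ((p - 1) * s))).
  apply: rcong_sum => s _ _; rewrite rmorphM rmorph_int mulrCA.
  by apply/rcongM/rcong_sym/sum_norm_ev/rcong_refl.
under [X in rcong _ X _]eq_bigr do rewrite mulr_sumr.
rewrite exchange_big /=; apply: rcong_sum => c _ _.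
by apply: alpha_indicator => t; apply: rho_teich.
Qed.

End TraceFormula.

(** * Descent to R, division by q^r - 1 and removal of the twist *)

Unset Implicit Arguments.

Theorem theorem3p1 (p a n d : nat) (Fq : finFieldType) (R : comNzRingType)
  (pi : {rmorphism R -> Fq}) (phi : {rmorphism R -> R}) (phiinv : R -> R)
  (r lam tau : nat) (L : finFieldType) (iota : {rmorphism Fq -> L})
  (Fb : hpoly Fq n) (F : hpoly R n) :
  prime p -> (0 < a)%N -> (0 < n)%N -> (0 < d)%N ->
  #|Fq| = (p ^ a)%N ->
  is_Witt_ring p pi ->
  (forall x, pi (phi x) = pi x ^+ p) ->
  cancel phi phiinv -> cancel phiinv phi ->
  #|L| = ((p ^ a) ^ r)%N ->
  (0 < r)%N -> (0 < lam)%N -> (0 < tau)%N ->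
  (lam%:R / ((p - 1) * a * r)%:R <= tau%:R :> rat) ->
  homog d Fb -> homog d F -> (forall u, pi (F u) = Fb u) ->
  rcong (p%:R ^+ lam : R)
    ((ntorus_zeros iota d Fb %/ ((p ^ a) ^ r - 1))%:R)
    ((((p ^ a) ^ r - 1) ^ n)%:R *
       \sum_(s < lam + tau)
          (alpha lam tau s)%:~R * traceA phiinv p (ppow F s) (d * s) (a * r)).
Proof.
move=> p_pr a_gt0 _ _ cardFq [pi_surj pi_ker _ _ _] phi_frob phiK phiinvK cardL.
move=> r_gt0 lam_gt0 tau_gt0 lam_le Fbd Fd F_lift.
have p_gt0 := prime_gt0 p_pr; have p_gt1 := prime_gt1 p_pr.
have cardLm : #|L| = (p ^ (a * r))%N by rewrite cardL expnM.
have lam_le_nat : (lam <= (p - 1) * (a * r) * tau)%N.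
  move: lam_le; rewrite Num.Theory.ler_pdivrMr ?Num.Theory.ltr0n; last first.
    by rewrite !muln_gt0 subn_gt0 p_gt1 a_gt0.
  by rewrite -natrM Num.Theory.ler_nat mulnC mulnA.
have [S [j [rho [rho_surj rho_ker rho_j j_rdvd]]]] :=
  @ex_unramified_extension p R Fq L pi iota pi_surj (fun x => proj1 (pi_ker x)).
have rho_surjb (y : L) : exists s, rho s == y.
  by have [s <-] := rho_surj y; exists s.
pose psi : {rmorphism R -> R} := HB.pack phiinv
  (GRing.isZmodMorphism.Build _ _ phiinv (can2_zmod_morphism phiK phiinvK))
  (GRing.isMonoidMorphism.Build _ _ phiinv (can2_monoid_morphism phiK phiinvK)).
pose T s := frob_trace p (a * r) d L phi F s.
have countE : rcong (p%:R ^+ lam : R) (ntorus_zeros iota d Fb)%:R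
    ((#|L| - 1)%:R ^+ n.+1 * \sum_(s < lam + tau) (alpha lam tau s)%:~R * T s).
  apply: j_rdvd; rewrite rmorphB rmorph_nat.
  exact: (torus_zeros_rcong p_pr cardLm phi_frob rho_surjb rho_ker rho_j Fd F_lift
    tau_gt0 lam_le_nat).
have {countE} : rcong (p%:R ^+ lam : R)
    (ntorus_zeros iota d Fb %/ (#|L| - 1))%:R
    ((#|L| - 1)%:R ^+ n * \sum_(s < lam + tau) (alpha lam tau s)%:~R * T s).
  (* Cancel one factor [#|L| - 1]: since |L| = p p^(ar-1), divisibility of (|L| - 1) x by p^lam
     reads x = p v x modulo p^lam with v = p^(ar-1), as in [rdvd_bootstrap]. *)
  move: countE; rewrite -{1}(divnK (dvd_ntorus_zeros iota d Fb)) natrM mulrC exprS.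
  rewrite -mulrA /rcong -mulrBr; set x := (_ - _) => Lx.
  apply: (@rdvd_bootstrap _ _ (p ^ (a * r).-1)%:R).
  rewrite -natrM -expnS prednK ?muln_gt0 ?a_gt0 // -cardLm.
  rewrite /rcong -opprB; apply: rdvdN.
  rewrite (_ : _ - x = (#|L| - 1)%:R * x) //.
  by rewrite natrB ?mulrBl ?mul1r // (leq_trans _ (finNzRing_gt1 L)).
(* Applying phi^(-ar) fixes all integers and turns each [T s] into the trace. *)
move=> /(rdvd_rmorph (rmorph_iter psi (a * r))).
rewrite rmorphXn rmorph_nat rmorphB rmorph_nat rmorphM rmorphXn rmorph_nat rmorph_sum.
rewrite cardL natrX /=.
under eq_bigr => s _.
  rewrite rmorphM rmorph_int rmorph_iterE /T /frob_trace /frobF cardLm.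
  rewrite -(@traceAE R n p phi psi p_gt0 phiK).
over.
by [].
Qed.
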